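(* Let $R$ be a nonzero associative unital ring, $n$ a positive integer, $G$ a group, $\rho$ a preorder on $\overline{n}=\{1,\ldots,n\}$, and suppose that $M_n(\rho,R)$ is equipped with a very good $G$-grading, induced by the $G$-grading $(\rho_g)_{g\in G}$ on $\rho$. Then the following assertions are equivalent: (i) $M_n(\rho,R)$ is epsilon-strongly $G$-graded; (ii) for every $g\in G$ and every $(i,j)\in\rho_g$, we have $(i,i)\in\rho_g\rho_{g^{-1}}$ and $(j,j)\in\rho_{g^{-1}}\rho_g$. In that case, for each $g\in G$, we have $$\epsilon_g=\sum_{i\in\overline{n},\ (i,i)\in\rho_g\rho_{g^{-1}}}e_{i,i}.$$
   Context: For $X,Y\subseteq\overline{n}\times\overline{n}$ put $XY=\{(i,k)\mid \exists j\in\overline{n}:\ (i,j)\in X,\ (j,k)\in Y\}$. A preorder is a reflexive and transitive relation. A $G$-grading on a preorder $\rho$ is a family $(\rho_g)_{g\in G}$ of pairwise disjoint (possibly empty) subsets of $\rho$ with $\rho=\bigcup_{g\in G}\rho_g$ and $\rho_g\rho_h\subseteq\rho_{gh}$ for all $g,h\in G$. $e_{i,j}$ is the $n\times n$ matrix over $R$ with $1$ in position $(i,j)$ and zeros elsewhere; $M_n(\rho,R)=\sum_{(i,j)\in\rho}Re_{i,j}\subseteq M_n(R)$ is the structural matrix ring. A $G$-grading on $S=M_n(\rho,R)$ is very good if there is a $G$-grading $(\rho_g)_{g\in G}$ on $\rho$ with $S_g=\sum_{(i,j)\in\rho_g}Re_{i,j}$ for all $g\in G$; it is then said to be induced by $(\rho_g)_{g\in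 G}$. A $G$-graded unital ring $S=\bigoplus_{g\in G}S_g$ is epsilon-strongly graded if for every $g\in G$ there is an element $\epsilon_g\in S_gS_{g^{-1}}$ such that $\epsilon_gs=s\epsilon_{g^{-1}}=s$ for all $g\in G$ and $s\in S_g$ (the product of additive subgroups is the additive subgroup generated by products). The elements $\epsilon_g$ are then uniquely determined, and $\epsilon_g$ in the claim refers to them. *)

(* Defs.v *)
From HB Require Import structures.
From mathcomp Require Import all_boot all_order all_algebra.
From mathcomp Require Import boolp classical_sets.

Set Implicit Arguments.
Unset Strict Implicit.
Unset Printing Implicit Defensive.

Import GRing.Theory.
Local Open Scope ring_scope.

Definition rel_comp n (X Y : {set 'I_n * 'I_n}) : {set 'I_n * 'I_n} :=
  [set p | [exists j, ((p.1, j) \in X) && ((j, p.2) \in Y)]]%SET.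

Record preorder n := Preorder {
  preorder_set :> {set 'I_n * 'I_n};
  preorder_refl : forall i, (i, i) \in preorder_set;
  preorder_trans : forall i j k,
    (i, j) \in preorder_set -> (j, k) \in preorder_set ->
    (i, k) \in preorder_set }.

Definition rel_grading (G : groupType) n (rho : preorder n)
    (rho_ : G -> {set 'I_n * 'I_n}) : Prop :=
  [/\ forall g h, g != h -> [disjoint rho_ g & rho_ h],
      forall p, p \in rho <-> exists g, p \in rho_ g &
      forall g h, rel_comp (rho_ g) (rho_ h) \subset rho_ (g * h)%g].

(* [span_units R X] is the sum of the R e_{i,j} over (i, j) in X, where
   e_{i,j} is [delta_mx i j]. *)
Definition span_units (R : nzRingType) n (X : {set 'I_n * 'I_n}) :
    set 'M[R]_n :=
  [set A | exists c : 'I_n * 'I_n -> R,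
             A = \sum_(p in X) c p *: delta_mx p.1 p.2]%classic.

Lemma span_unitsP (R : nzRingType) n (X : {set 'I_n * 'I_n}) (A : 'M[R]_n) :
  span_units X A <-> forall i j, (i, j) \notin X -> A i j = 0.
Proof.
split=> [[c ->] i j ijX | A0].
  rewrite summxE big1 // => -[k l] klX /=; rewrite !mxE.
  case: eqP => [ik|_]; case: eqP => [jl|_] /=; rewrite ?mulr0 //.
  by move: ijX; rewrite ik jl klX.
exists (fun p => A p.1 p.2); rewrite [LHS]matrix_sum_delta pair_big /=.
rewrite [LHS](bigID (mem X)) /= [X in _ + X]big1 ?addr0 // => -[i j] /= ijX.
by rewrite A0 // scale0r.
Qed.

Section StructuralMatrixRing.
Variables (R : nzRingType) (n : nat) (rho : preorder n).

Definition struct_mx_pred : {pred 'M[R]_n} := [pred A | `[< span_units rho A >]].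

Lemma struct_mx_subring_closed : subring_closed struct_mx_pred.
Proof.
have memP (A : 'M[R]_n) : reflect (forall i j, (i, j) \notin preorder_set rho -> A i j = 0)
                      (A \in struct_mx_pred).
  by apply: (iffP (asboolP _)) => /span_unitsP.
split.
- apply/memP => i j; rewrite mxE; case: eqP => [->|//].
  by rewrite preorder_refl.
- move=> A B /memP A0 /memP B0; apply/memP => i j ij.
  by rewrite !mxE A0 // B0 // subr0.
- move=> A B /memP A0 /memP B0; apply/memP => i j ij.
  rewrite mxE big1 // => k _.
  have [ik|/A0->] := boolP ((i, k) \in preorder_set rho); last by rewrite mul0r.
  have [kj|/B0->] := boolP ((k, j) \in preorder_set rho); last by rewrite mulr0.
  by rewrite (preorder_trans ik kj) in ij.
Qed.

HB.instance Definition _ :=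
  GRing.isSubringClosed.Build 'M[R]_n struct_mx_pred struct_mx_subring_closed.

(* The ring M_n(rho, R), with the operations of 'M[R]_n.  It is declared only
   as a [pzRingType] since it is the zero ring when n = 0. *)
Record struct_mx := StructMx {
  struct_mx_val :> 'M[R]_n;
  _ : struct_mx_val \in struct_mx_pred }.

HB.instance Definition _ := [isSub for struct_mx_val].
HB.instance Definition _ := [Choice of struct_mx by <:].
HB.instance Definition _ :=
  GRing.SubChoice_isSubPzRing.Build 'M[R]_n struct_mx_pred struct_mx
    struct_mx_subring_closed.

End StructuralMatrixRing.

Section GradedRings.
Variables (G : groupType) (S : pzRingType).

Definition add_subgroup (A : set S) : Prop :=
  A 0 /\ forall x y, A x -> A y -> A (x - y).

Definition subgroup_mul (A B : set S) : set S :=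
  smallest add_subgroup [set x * y | x in A & y in B]%classic.

(* The second and third clauses say that S is the direct sum of the S_g. *)
Definition ring_grading (S_ : G -> set S) : Prop :=
  [/\ forall g, add_subgroup (S_ g),
      forall x : S, exists (s : seq G) (f : G -> S),
        (forall g, S_ g (f g)) /\ x = \sum_(g <- s) f g,
      forall (s : seq G) (f : G -> S), uniq s -> (forall g, S_ g (f g)) ->
        \sum_(g <- s) f g = 0 -> forall g, g \in s -> f g = 0 &
      forall g h x y, S_ g x -> S_ h y -> S_ (g * h)%g (x * y)].

Definition epsilon_family (S_ : G -> set S) (eps : G -> S) : Prop :=
  (forall g, subgroup_mul (S_ g) (S_ g^-1%g) (eps g)) /\
  (forall g s, S_ g s -> eps g * s = s /\ s * eps g^-1%g = s).

Definition epsilon_strongly_graded (S_ : G -> set S) : Prop :=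
  ring_grading S_ /\ exists eps : G -> S, epsilon_family S_ eps.

End GradedRings.

Definition induced_by (R : nzRingType) n (rho : preorder n) (G : groupType)
    (S_ : G -> set (struct_mx R rho)) (rho_ : G -> {set 'I_n * 'I_n}) : Prop :=
  forall g, S_ g =
    [set x | span_units (rho_ g) (struct_mx_val x)]%classic.

(* Main.v *)
(* Elements of [S_g S_{g^-1}] are supported on the pairs in [rho_g rho_{g^-1}].
   Hence [epsilon_g e_{i,j} = e_{i,j}] for (i, j) in [rho_g] forces the (i, i)
   entry of [epsilon_g] to be 1, so that (i, i) lies in [rho_g rho_{g^-1}];
   it also determines the i-th column of [epsilon_g].  The remaining columns
   vanish by the support condition and (ii).  Conversely, under (ii) the
   idempotent in the displayed formula is a two-sided local unit, and it is a
   sum of products [e_{i,j} e_{j,i}]. *)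
Require Import Defs.
From mathcomp Require Import all_boot all_order all_algebra.
From mathcomp Require Import boolp classical_sets.

Set Implicit Arguments.
Unset Strict Implicit.
Unset Printing Implicit Defensive.

Import GRing.Theory.
Local Open Scope ring_scope.

Lemma rel_compP n (X Y : {set 'I_n * 'I_n}) (i k : 'I_n) :
  reflect (exists2 j, (i, j) \in X & (j, k) \in Y) ((i, k) \in rel_comp X Y).
Proof.
rewrite inE; apply: (iffP existsP) => [[j /andP[? ?]]|[j ? ?]]; exists j => //.
exact/andP.
Qed.

Section AdditiveSubgroups.
Variable S : pzRingType.

Lemma add_subgroupD (A : set S) (x y : S) :
  add_subgroup A -> A x -> A y -> A (x + y).
Proof.
case=> A0 AB Ax Ay.
(* [add_subgroup] gives closure under subtraction only, so the sum is reached as [x - (0 - y)]. *)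
by have := AB _ _ Ax (AB _ _ A0 Ay); rewrite sub0r opprK.
Qed.

Lemma add_subgroup_sum (A : set S) (I : finType) (P : pred I) (F : I -> S) :
  add_subgroup A -> (forall i, P i -> A (F i)) -> A (\sum_(i | P i) F i).
Proof.
move=> Agrp AF; apply: big_ind => // [|x y Ax Ay]; first by case: Agrp.
exact: add_subgroupD.
Qed.

Lemma add_subgroup_subgroup_mul (A B : set S) : add_subgroup (subgroup_mul A B).
Proof.
split=> [C [[C0 _] _] //|x y ABx ABy C CAB].
by case: (CAB) => -[_ CB] _; apply: CB; [exact: ABx|exact: ABy].
Qed.

Lemma subgroup_mulM (A B : set S) (x y : S) :
  A x -> B y -> subgroup_mul A B (x * y).
Proof. by move=> Ax By C [_]; apply; exists x => //; exists y. Qed.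

End AdditiveSubgroups.

Lemma mulmx_delta_entry (R : nzRingType) n (A : 'M[R]_n) (i j k l : 'I_n) :
  (A *m delta_mx i j) k l = A k i *+ (l == j).
Proof.
rewrite mxE (bigD1 i) //= big1 => [|m /negPf mi]; rewrite mxE.
  by rewrite eqxx addr0 /= mulr_natr.
by rewrite mi mulr0.
Qed.

Lemma delta_mulmx_entry (R : nzRingType) n (A : 'M[R]_n) (i j k l : 'I_n) :
  (delta_mx i j *m A) k l = A j l *+ (k == i).
Proof.
rewrite mxE (bigD1 j) //= big1 => [|m /negPf mj]; rewrite mxE.
  by rewrite eqxx andbT addr0 mulr_natl.
by rewrite mj andbF mul0r.
Qed.

(** In diagonal form, multiplication on the left scales rows and on the right scales columns. *)
Lemma sum_delta_diag (R : nzRingType) n (P : pred 'I_n) :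
  \sum_(i | P i) delta_mx i i = diag_mx (\row_i (P i)%:R) :> 'M[R]_n.
Proof.
rewrite diag_mx_sum_delta big_mkcond; apply: eq_bigr => i _; rewrite mxE.
by case: (P i); rewrite ?scale1r ?scale0r.
Qed.

Section StructuralMatrices.
Variables (R : nzRingType) (n : nat) (rho : preorder n).

Lemma struct_mxM (x y : struct_mx R rho) :
  struct_mx_val (x * y) = struct_mx_val x *m struct_mx_val y.
Proof. by []. Qed.

(* Junk value [0] when (i, j) is not in [rho]. *)
Definition struct_delta (i j : 'I_n) : struct_mx R rho :=
  insubd (0 : struct_mx R rho) (delta_mx i j).

Lemma span_units_delta (X : {set 'I_n * 'I_n}) (i j : 'I_n) :
  (i, j) \in X -> span_units X (delta_mx i j : 'M[R]_n).
Proof.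
move=> ijX; apply/span_unitsP => k l; rewrite mxE.
by case: eqP => [->|//]; case: eqP => [->|//]; rewrite ijX.
Qed.

Lemma struct_deltaE (i j : 'I_n) : (i, j) \in (rho : {set _}) ->
  struct_mx_val (struct_delta i j) = delta_mx i j.
Proof.
move=> ij; apply: (insubdK (0 : struct_mx R rho)).
exact/asboolP/span_units_delta.
Qed.

(** The matrices supported on [rel_comp X Y] form an additive subgroup containing every product
    [a * b], and [subgroup_mul] is the smallest such subgroup. *)
Lemma span_units_subgroup_mul (X Y : {set 'I_n * 'I_n})
    (A B : set (struct_mx R rho)) (x : struct_mx R rho) :
    (forall a, A a -> span_units X (struct_mx_val a)) ->
    (forall b, B b -> span_units Y (struct_mx_val b)) ->
  subgroup_mul A B x -> span_units (rel_comp X Y) (struct_mx_val x).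
Proof.
move=> AX BY.
apply: (_ : subgroup_mul A B `<=` [set x : struct_mx R rho |
  span_units (rel_comp X Y) (struct_mx_val x)])%classic.
apply: smallest_sub; first split.
- by apply/span_unitsP => i j _; rewrite mxE.
- move=> y z /span_unitsP y0 /span_unitsP z0; apply/span_unitsP => i j ij.
  by rewrite !mxE y0 // z0 // subr0.
move=> _ [a /AX/span_unitsP a0 [b /BY/span_unitsP b0 <-]].
apply/span_unitsP => i k ik; rewrite mxE big1 // => j _.
have [ij|/a0->] := boolP ((i, j) \in X); last by rewrite mul0r.
have [jk|/b0->] := boolP ((j, k) \in Y); last by rewrite mulr0.
by case/rel_compP: ik; exists j.
Qed.

Section Grading.
Variables (G : groupType) (S_ : G -> set (struct_mx R rho)).
Variable rho_ : G -> {set 'I_n * 'I_n}.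
Hypotheses (rho_grading : rel_grading rho rho_) (S_induced : induced_by S_ rho_).

Lemma rel_grading_sub g p : p \in rho_ g -> p \in (rho : {set _}).
Proof. by case: rho_grading => _ rhoP _ pg; apply/rhoP; exists g. Qed.

Lemma struct_delta_homogeneous g i j :
  (i, j) \in rho_ g -> S_ g (struct_delta i j).
Proof.
move=> ij; rewrite S_induced /= struct_deltaE; last exact: rel_grading_sub ij.
exact: span_units_delta.
Qed.

Section EpsilonFamily.
Variable eps : G -> struct_mx R rho.
Hypothesis epsP : epsilon_family S_ eps.

Lemma epsilon_entry0 g i j : (i, j) \notin rel_comp (rho_ g) (rho_ g^-1%g) ->
  struct_mx_val (eps g) i j = 0.
Proof.
move=> ij; have [/(_ g) epsg _] := epsP.
have S_sub h x : S_ h x -> span_units (rho_ h) (struct_mx_val x).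
  by rewrite S_induced.
have/span_unitsP := span_units_subgroup_mul (S_sub g) (S_sub g^-1%g) epsg.
exact.
Qed.

(** Right multiplication by [delta_mx i j] moves column i to column j, so this compares the (k, j)
    entries in [eps g * struct_delta i j = struct_delta i j]. *)
Lemma epsilon_col g i j k : (i, j) \in rho_ g ->
  struct_mx_val (eps g) k i = (k == i)%:R.
Proof.
move=> ij; have [_ /(_ _ _ (struct_delta_homogeneous ij))[E _]] := epsP.
move/(congr1 (fun x => struct_mx_val x k j)): E.
rewrite struct_mxM struct_deltaE; last exact: rel_grading_sub ij.
by rewrite mulmx_delta_entry mxE !eqxx andbT.
Qed.

Lemma epsilon_row g i j k : (i, j) \in rho_ g ->
  struct_mx_val (eps g^-1%g) j k = (k == j)%:R.
Proof.
move=> ij; have [_ /(_ _ _ (struct_delta_homogeneous ij))[_ E]] := epsP.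
move/(congr1 (fun x => struct_mx_val x i k)): E.
rewrite struct_mxM struct_deltaE; last exact: rel_grading_sub ij.
by rewrite delta_mulmx_entry mxE !eqxx.
Qed.

(** Otherwise a diagonal entry of [eps g] or of [eps g^-1] would be 0 by its support and 1 by the
    unit law, but 1 is nonzero in R. *)
Lemma epsilon_diag_rel_comp g i j : (i, j) \in rho_ g ->
  (i, i) \in rel_comp (rho_ g) (rho_ g^-1%g) /\
  (j, j) \in rel_comp (rho_ g^-1%g) (rho_ g).
Proof.
move=> ij; split; apply/negPn/negP => notin.
  have := epsilon_col i ij; rewrite epsilon_entry0 // eqxx => /esym/eqP.
  by rewrite oner_eq0.
have := epsilon_row j ij; rewrite epsilon_entry0 ?invgK // eqxx => /esym/eqP.
by rewrite oner_eq0.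
Qed.

Lemma epsilonE g : struct_mx_val (eps g) =
  \sum_(i | (i, i) \in rel_comp (rho_ g) (rho_ g^-1%g)) delta_mx i i.
Proof.
rewrite sum_delta_diag; apply/matrixP => k i; rewrite !mxE.
have [ii|notin] := boolP ((i, i) \in rel_comp (rho_ g) (rho_ g^-1%g)).
  have /rel_compP[j ij _] := ii.
  by rewrite (epsilon_col k ij); case: eqP => // ->; rewrite ii.
rewrite epsilon_entry0; last first.
  (* If some (k, i) lies in the support, then some (j, i) lies in [rho_ g^-1]. The second half of
     [epsilon_diag_rel_comp] at [g^-1] then puts (i, i) in the support too. *)
  apply: contra notin => /rel_compP[j _ /epsilon_diag_rel_comp[_]].
  by rewrite invgK.
by case: eqP => [->|//]; rewrite (negPf notin).
Qed.

End EpsilonFamily.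

Lemma diag_epsilon_family :
    (forall g i j, (i, j) \in rho_ g ->
       (i, i) \in rel_comp (rho_ g) (rho_ g^-1%g) /\
       (j, j) \in rel_comp (rho_ g^-1%g) (rho_ g)) ->
  epsilon_family S_ (fun g =>
    \sum_(i | (i, i) \in rel_comp (rho_ g) (rho_ g^-1%g)) struct_delta i i).
Proof.
move=> rho_diag.
have sumE g : struct_mx_val (\sum_(i | (i, i) \in rel_comp (rho_ g) (rho_ g^-1%g))
    struct_delta i i) =
    diag_mx (\row_i ((i, i) \in rel_comp (rho_ g) (rho_ g^-1%g))%:R).
  rewrite -sum_delta_diag [LHS](raddf_sum (\val : struct_mx R rho -> 'M[R]_n)).
  (* Reflexivity of [rho] rules out the junk value of [struct_delta i i]. *)
  by apply: eq_bigr => i _; exact/struct_deltaE/preorder_refl.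
split=> [g|g s].
  apply: add_subgroup_sum; first exact: add_subgroup_subgroup_mul.
  move=> i /rel_compP[j ij ji].
  (* The witness j of (i, i) in the composite gives the factors, homogeneous of degrees [g] and
     [g^-1]. *)
  suff -> : struct_delta i i = struct_delta i j * struct_delta j i.
    by apply: subgroup_mulM; exact: struct_delta_homogeneous.
  apply: val_inj; rewrite [RHS]struct_mxM /= !struct_deltaE ?mul_delta_mx ?preorder_refl //.
    exact: rel_grading_sub ji.
  exact: rel_grading_sub ij.
rewrite S_induced => /span_unitsP s0; split; apply: val_inj.
  rewrite [LHS]struct_mxM sumE mul_diag_mx; apply/matrixP => i j; rewrite !mxE.
  (* The scaling factor of row i is 1 as soon as (i, j) is in [rho_ g]; elsewhere the entry of [s]
     is already 0. *)
  have [/rho_diag[-> _]|/s0 ->] := boolP ((i, j) \in rho_ g).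
    by rewrite mul1r.
  by rewrite mulr0.
(* The element used here has degree [g^-1]; [invgK] turns its index condition into the second half
   of [rho_diag]. *)
rewrite [LHS]struct_mxM sumE mul_mx_diag invgK; apply/matrixP => i j; rewrite !mxE.
have [/rho_diag[_ ->]|/s0 ->] := boolP ((i, j) \in rho_ g).
  by rewrite mulr1.
by rewrite mul0r.
Qed.

End Grading.
End StructuralMatrices.

Theorem corollary22 (R : nzRingType) (n : nat) (n_gt0 : (0 < n)%N)
    (G : groupType) (rho : preorder n)
    (S_ : G -> set (struct_mx R rho)) (S_grading : ring_grading S_)
    (rho_ : G -> {set 'I_n * 'I_n}) (rho_grading : rel_grading rho rho_)
    (S_induced : induced_by S_ rho_) :
  (epsilon_strongly_graded S_ <->
   forall (g : G) (i j : 'I_n), (i, j) \in rho_ g ->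
     (i, i) \in rel_comp (rho_ g) (rho_ g^-1%g) /\
     (j, j) \in rel_comp (rho_ g^-1%g) (rho_ g)) /\
  (epsilon_strongly_graded S_ ->
   forall eps : G -> struct_mx R rho, epsilon_family S_ eps ->
   forall g : G,
     struct_mx_val (eps g) =
     \sum_(i : 'I_n | (i, i) \in rel_comp (rho_ g) (rho_ g^-1%g))
        delta_mx i i).
Proof.
split; last by move=> _ eps epsP g; exact: epsilonE.
split=> [[_ [eps epsP]] g i j|rho_diag].
  exact: epsilon_diag_rel_comp rho_grading S_induced _ epsP _ _ _.
split=> //; eexists; exact: diag_epsilon_family rho_grading S_induced rho_diag.
Qed.
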